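(* Let $G$ be a tight graph. Let $F^{\ast}=\{f_1,f_2,\dots,f_m\}$ be the set of all non-triangular faces of $G$, and for each $i=1,\dots,m$ let $v_i$ and $v_i'$ be distinct vertices of $f_i$. Then $G$ has a Hamiltonian vertex-face tour containing $(v_i,f_i,v_i')$ for each $i=1,2,\dots,m$.
   Context: A tight graph is a 3-connected plane graph in which no two non-triangular faces share a vertex. A spanning vertex-face tour of a plane graph $G$ is a disjoint union $T$ of closed alternating sequences of vertices and faces of $G$ such that each face of $G$ appears exactly once in $T$, and each closed component $(v_1,f_1,v_2,f_2,\dots,v_k,f_k,v_1)$ satisfies that $v_j$ and $v_{j+1}$ are distinct and both incident to the face $f_j$ for $j=1,\dots,k$ (indices modulo $k$). Vertices may be repeated in $T$ or may not appear at all. A Hamiltonian vertex-face tour is a spanning vertex-face tour consisting of a single closed sequence (i.e. connected). A tour contains $(u,f,w)$ means that the face $f$ is immediately preceded and followed by the vertices $u$ and $w$ in it. *)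

(* Defs.v *)
From mathcomp Require Import all_boot all_fingroup.

Set Implicit Arguments.
Unset Strict Implicit.
Unset Printing Implicit Defensive.

(* Plane graphs are finite simple graphs together with a
   combinatorial embedding in the sphere (a rotation system of genus 0). *)

Record sgraph := SGraph {
  vertex :> finType;
  adj : rel vertex;
  adj_sym : symmetric adj;
  adj_irr : irreflexive adj }.

Section Graph.
Variable G : sgraph.

Definition edges : {set {set G}} :=
  [set [set p.1; p.2] | p : G * G & adj p.1 p.2].

Definition connected_off (X : {set G}) : Prop :=
  forall u v : G, u \notin X -> v \notin X ->
    connect [rel x y | [&& adj x y, x \notin X & y \notin X]] u v.

Definition k_connected (k : nat) : Prop :=
  k < #|G| /\ forall X : {set G}, #|X| < k -> connected_off X.

Definition dart := {p : G * G | adj p.1 p.2}.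

Definition src (d : dart) : G := (val d).1.
Definition tgt (d : dart) : G := (val d).2.

Fact rev_subproof (d : dart) : adj (tgt d, src d).1 (tgt d, src d).2.
Proof. by rewrite /= adj_sym; exact: (valP d). Qed.

Definition rev_dart (d : dart) : dart :=
  exist (fun p : G * G => adj p.1 p.2) (tgt d, src d) (rev_subproof d).

Lemma rev_dartK : involutive rev_dart.
Proof. by move=> d; apply: val_inj; case: d => [[u v] uv]. Qed.

Definition rev_perm : {perm dart} := perm (can_inj rev_dartK).

(* The rotation lists the darts leaving each vertex in cyclic order. *)
Definition rotation_system (r : {perm dart}) : Prop :=
  forall d : dart, porbit r d = [set d' | src d' == src d].

(* Permutations compose left to right: face_perm r maps the dart (u, v) to
   r (v, u), the next dart on the boundary walk of the face to one side of
   (u, v).  The cycles of face_perm r are the facial walks. *)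
Definition face_perm (r : {perm dart}) : {perm dart} := (rev_perm * r)%g.

End Graph.

(* For a connected graph with at least one edge, V + F = E + 2 says exactly
   that the embedding given by the rotation system is in the sphere; the
   facial walk of the unbounded face of a plane drawing is one of the orbits
   like any other. *)
Record plane_graph := PlaneGraph {
  graph_of :> sgraph;
  rotation : {perm dart graph_of};
  rotationP : rotation_system rotation;
  plane_connected : connected_off (@set0 graph_of);
  plane_euler : #|graph_of| + #|porbits (face_perm rotation)|
                = #|edges graph_of| + 2 }.

Section PlaneGraph.
Variable G : plane_graph.

Definition face :=
  {F : {set dart G} | F \in porbits (face_perm (rotation G))}.

Definition incident (v : G) (f : face) : bool :=
  [exists d in val f, src d == v].

(* The number of darts is the length of the facial walk; since G is simple,
   a facial walk of length 3 is a 3-cycle. *)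
Definition triangular (f : face) : bool := #|val f| == 3.

Definition nontriangular_faces : {set face} := [set f | ~~ triangular f].

Definition tight : Prop :=
  k_connected G 3 /\
  forall f g : face, f \in nontriangular_faces -> g \in nontriangular_faces ->
    f != g -> forall v : G, ~~ (incident v f && incident v g).

(* The closed sequence (v_1, f_1, v_2, f_2, ..., v_k, f_k, v_1), k >= 1, is
   the list of pairs [:: (v_1, f_1); ...; (v_k, f_k)]. *)
Definition closed_component (c : seq (G * face)) : bool :=
  (c != [::]) &&
  path.cycle (fun p q => [&& p.1 != q.1, incident p.1 p.2 & incident q.1 p.2]) c.

Definition spanning_tour (T : seq (seq (G * face))) : bool :=
  all closed_component T &&
  perm_eq [seq p.2 | p <- flatten T] (enum {: face}).

Definition hamiltonian_tour (T : seq (seq (G * face))) : bool :=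
  spanning_tour T && (size T == 1).

(* In a spanning tour a face occurs once, so the successor of (u, f) given by
   [next] is unambiguous. *)
Definition traverses (c : seq (G * face)) (u : G) (f : face) (w : G) : bool :=
  ((u, f) \in c) && ((next c (u, f)).1 == w).

(* A closed sequence and its reversal are the same tour: the two vertices
   next to f in the tour are u and w, in either direction of travel. *)
Definition tour_contains (T : seq (seq (G * face)))
    (u : G) (f : face) (w : G) : bool :=
  has (fun c => traverses c u f w || traverses c w f u) T.

End PlaneGraph.

(* Main.v *)
(* Select for every face f the two vertices preceding and following it in the
   tour.  A selection is a multigraph H on the vertices with one edge per face,
   and a Hamiltonian tour is an Eulerian circuit of H; so one needs a selection
   that is prescribed on the nontriangular faces, has even degrees, and whose
   edges lie in one component.

   Even degrees: choose an edge z_t of each triangle t so that the edges z_t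
   connect all vertices.  Letting t select one or the other of the two edges
   different from z_t changes the parities exactly at the ends of z_t, so the
   parities can be corrected by solving a linear system over F_2.  The z_t are
   built along the dual graph restricted to triangles: start from a dual cycle,
   each triangle of which takes the edge to the next one, and let every further
   triangle take an edge other than the one through which it was reached.

   One component: if two triangles abc and abd lie in different components, then
   up to exchanging a and b they select ac and bd; selecting bc and ad instead
   preserves parities and merges the two components, since an even graph has no
   bridge.  Hence a largest component contains all triangles, because tightness
   makes the triangles connected in the dual graph.

   Planarity is used through one fact: a face of a 2-connected plane graph does
   not visit a vertex twice.  This follows from the vanishing of the first
   homology mod 2, obtained from Euler's formula by counting ranks. *)

Require Import Defs.
From mathcomp Require Import all_boot all_fingroup all_algebra.

Set Implicit Arguments.
Unset Strict Implicit.
Unset Printing Implicit Defensive.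

(** * Even multigraphs and Eulerian circuits *)

Section Multigraph.
Variables V F : finType.
Implicit Types (h : F -> V * V) (f : F) (u w x : V) (l : seq (V * F)).

Definition joins h f u w := (h f == (u, w)) || (h f == (w, u)).

(** The contribution of [f] to the degree of [x] mod 2; a loop contributes nothing. *)
Definition meets h f x := ((h f).1 == x) (+) ((h f).2 == x).

Definition even_graph h := forall x, \big[addb/false]_f meets h f x = false.

Definition no_crossing h (Y : {set V}) :=
  forall f, ((h f).1 \in Y) = ((h f).2 \in Y).

(** Connectedness of the edges only, expressed by cuts: isolated vertices are allowed, since a tour
    may miss vertices. *)
Definition connected_graph h := forall Y : {set V}, no_crossing h Y ->
  forall f g, ((h f).1 \in Y) = ((h g).1 \in Y).

Lemma joins_meets h f u w x : joins h f u w -> meets h f x = (u == x) (+) (w == x).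
Proof. by rewrite /meets => /orP[] /eqP->; rewrite //= addbC. Qed.

Lemma big_eq_vertex u (y : V -> bool) : \big[addb/false]_x ((u == x) && y x) = y u.
Proof.
rewrite (bigD1 u) //= eqxx big1 ?addbF // => x /negbTE.
by rewrite eq_sym => ->.
Qed.

Lemma big_meets h f (y : V -> bool) :
  \big[addb/false]_x (meets h f x && y x) = y (h f).1 (+) y (h f).2.
Proof.
under eq_bigr do rewrite andb_addl.
by rewrite big_split /= !big_eq_vertex.
Qed.

Lemma big_ends h (y : V -> bool) :
  \big[addb/false]_f (y (h f).1 (+) y (h f).2)
  = \big[addb/false]_x ((\big[addb/false]_f meets h f x) && y x).
Proof.
transitivity (\big[addb/false]_f \big[addb/false]_x (meets h f x && y x)).
  by apply: eq_bigr => f _; rewrite big_meets.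
by rewrite exchange_big; apply: eq_bigr => x _; rewrite /= big_distrl.
Qed.

Lemma even_cut h (Y : {set V}) : even_graph h ->
  \big[addb/false]_f (((h f).1 \in Y) (+) ((h f).2 \in Y)) = false.
Proof. by move=> ev; rewrite (big_ends h (mem Y)) big1 // => x _; rewrite ev. Qed.

(** * Trails and Eulerian circuits *)

Definition start w l := if l is p :: _ then p.1 else w.

(** An entry is a vertex with the edge leaving it; the final vertex [w] is kept apart. *)
Fixpoint trail h l w :=
  if l is p :: l' then joins h p.2 p.1 (start w l') && trail h l' w else true.

Definition step h (p q : V * F) := joins h p.2 p.1 q.1.

Lemma start_cat w l1 l2 : start w (l1 ++ l2) = start (start w l2) l1.
Proof. by case: l1. Qed.

Lemma trail_cat h w l1 l2 :
  trail h (l1 ++ l2) w = trail h l1 (start w l2) && trail h l2 w.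
Proof. by elim: l1 => //= p l1 ->; rewrite start_cat andbA. Qed.

Lemma trail_path h p q l : trail h (p :: l) q.1 = path (step h) p (rcons l q).
Proof. by elim: l p => //= p' l IHl p; rewrite -IHl. Qed.

Lemma trail_meets h l w x : trail h l w ->
  \big[addb/false]_(p <- l) meets h p.2 x = (start w l == x) (+) (w == x).
Proof.
elim: l => [|p l IHl] /=; first by rewrite big_nil addbb.
case/andP=> j /IHl; rewrite big_cons (joins_meets _ j) => ->.
by rewrite addbA addbK.
Qed.

Lemma ends_joins h f x : x = (h f).1 \/ x = (h f).2 -> exists y, joins h f x y.
Proof.
by case=> ->; [exists (h f).2 | exists (h f).1]; rewrite /joins -surjective_pairing eqxx ?orbT.
Qed.

Lemma euler_tour h : even_graph h -> connected_graph h -> 0 < #|F| ->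
  exists l, [/\ l != [::], path.cycle (step h) l & perm_eq (map snd l) (enum F)].
Proof.
move=> ev con F0.
pose good n := [exists t : n.-tuple (V * F), exists w : V, trail h t w && uniq (map snd t)].
have good_size l w : trail h l w -> uniq (map snd l) -> good (size l).
  by move=> tl ul; apply/existsP; exists (in_tuple l); apply/existsP; exists w; rewrite tl.
have ub n : good n -> n <= #|F|.
  case/existsP=> t /existsP[w /andP[_ ut]].
  by rewrite -(size_tuple t) -(size_map snd) -(card_uniqP ut) max_card.
have ex : exists n, good n by exists 0; apply: (@good_size [::] (h (enum_val (Ordinal F0))).1).
case: (ex_maxnP ex ub) => n /existsP[[l /= /eqP szl] /existsP[w /andP[tl ul]]] maxn.
have grow l' w' : trail h l' w' -> uniq (map snd l') -> size l' <= size l.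
  by move=> tl' ul'; rewrite szl; apply/maxn/(@good_size _ w').
(* An open maximal trail would leave an unused edge at its last vertex. *)
have closed : start w l = w.
  apply/eqP/negPn/negP => /negbTE sw.
  have /existsP[f /andP[fl fw]] : [exists f, (f \notin map snd l) && meets h f w].
    apply: contraT => /existsPn nof; exfalso.
    have := trail_meets w tl; rewrite eqxx sw /= -[\big[_/_]_(_ <- _) _](big_map snd xpredT (fun f => meets h f w)).
    rewrite big_uniq // big_mkcond /= => E.
    have := ev w; rewrite (eq_bigr (fun f => if f \in map snd l then meets h f w else false)) ?E // => f _.
    by have := nof f; case: (f \in _) => //=; case: meets.
  have /ends_joins[y jy] : w = (h f).1 \/ w = (h f).2.
    move: fw; rewrite /meets; case: eqP => [->|_]; first by left.
    by case: eqP => [->|] //; right.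
  have := @grow (l ++ [:: (w, f)]) y.
  rewrite trail_cat /= tl jy cats1 map_rcons rcons_uniq /= ul fl size_rcons ltnn.
  by move=> /(_ isT isT).
have [al|] := boolP [forall f, f \in map snd l]; last first.
  case/forallPn=> f0 f0l.
  have [/existsP[f /existsP[p /and3P[pl fl fp]]]|/existsPn none] := boolP [exists f, exists p : V * F,
      [&& p \in l, f \notin map snd l & (p.1 == (h f).1) || (p.1 == (h f).2)]].
    have /ends_joins[y jy] : p.1 = (h f).1 \/ p.1 = (h f).2.
      by case/orP: fp => /eqP; [left|right].
    case: (splitPr pl) tl ul closed fl grow => l1 l2.
    rewrite start_cat /= trail_cat /= => /and3P[t1 jp t2] ul cl fl grow.
    have jy' : joins h f y p.1 by rewrite /joins orbC.
    have tr : trail h ((y, f) :: (p :: l2) ++ l1) p.1.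
      by rewrite /= trail_cat start_cat cl jy' t1 jp t2.
    have un : uniq (map snd ((y, f) :: (p :: l2) ++ l1)).
      have pm : perm_eq (map snd ((p :: l2) ++ l1)) (map snd (l1 ++ p :: l2)).
        by rewrite !map_cat perm_catC.
      by rewrite map_cons cons_uniq (perm_uniq pm) (perm_mem pm) fl.
    by have := grow _ _ tr un; rewrite /= !size_cat /= addnC addnS ltnn.
  exfalso; case: l szl tl ul closed grow none f0l => [|p l] szl tl ul closed grow none f0l.
    have /ends_joins[y jy] : (h f0).1 = (h f0).1 \/ (h f0).1 = (h f0).2 by left.
    by have := @grow [:: ((h f0).1, f0)] y; rewrite /= jy => /(_ isT isT).
  (* No edge crosses the vertex set of the trail, yet [f0] lies outside it. *)
  pose Y := [set x in map fst (p :: l)].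
  have sub q : q \in p :: l -> ((h q.2).1 \in Y) && ((h q.2).2 \in Y).
    move=> ql; have [l1 [l2 E]] : exists l1 l2, p :: l = l1 ++ q :: l2.
      by case/splitPr: ql => l1 l2; exists l1, l2.
    have wY : w \in Y by rewrite in_set -closed /= mem_head.
    have qY : q.1 \in Y by rewrite in_set map_f.
    have sY : start w l2 \in Y.
      case: l2 E => //= q' l2 E; rewrite in_set map_f // E mem_cat !inE eqxx ?orbT //.
    have: joins h q.2 q.1 (start w l2).
      by move: tl; rewrite E trail_cat /= => /and3P[].
    by case/orP=> /eqP-> /=; rewrite qY sY.
  have out f : f \notin map snd (p :: l) -> ((h f).1 \notin Y) && ((h f).2 \notin Y).
    move=> fl; rewrite !in_set; apply/andP; split; apply/negP.
      case/mapP=> q ql qf; case/negP: (none f); apply/existsP; exists q.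
      by rewrite ql fl qf eqxx.
    case/mapP=> q ql qf; case/negP: (none f); apply/existsP; exists q.
    by rewrite ql fl qf eqxx orbT.
  have nc : no_crossing h Y.
    move=> f; have [/mapP[q ql ->]|/out/andP[/negbTE-> /negbTE->]//] := boolP (f \in map snd (p :: l)).
    by have /andP[-> ->] := sub _ ql.
  have := con Y nc p.2 f0; have /andP[-> _] := sub _ (mem_head p l).
  by have /andP[/negbTE-> _] := out _ f0l.
exists l; split.
- case: l al {szl tl ul closed grow} => // /forallP al.
  by have := al (enum_val (Ordinal F0)).
- case: l closed tl {szl ul al grow} => [//|p l] closed tl.
  by rewrite -closed trail_path in tl.
- apply: uniq_perm => //; first exact: enum_uniq.
  by move=> f; rewrite mem_enum (forallP al).
Qed.

(** * Components and the exchange of two edges *)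

Definition link h u w := [exists f, joins h f u w].

Definition reach h v := [set f | connect (link h) v (h f).1].

Lemma connect_no_crossing h (Y : {set V}) u w :
  no_crossing h Y -> connect (link h) u w -> (u \in Y) = (w \in Y).
Proof.
move=> nc /connectP[s + ->]; elim: s u => //= y s IHs u /andP[/existsP[f j] /IHs <-].
by have := nc f; case/orP: j => /eqP->.
Qed.

Lemma no_crossing_component h v : no_crossing h [set u | connect (link h) v u].
Proof.
move=> f; have con u w : joins h f u w -> connect (link h) v u -> connect (link h) v w.
  by move=> j vu; apply: connect_trans vu (connect1 _); apply/existsP; exists f.
rewrite !inE; apply/idP/idP; apply: con; by rewrite /joins -surjective_pairing eqxx ?orbT.
Qed.

Lemma reach_connected h v : reach h v = setT -> connected_graph h.
Proof.
move=> rT Y nc f g.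
have vY k : (h k).1 \in Y = (v \in Y).
  by apply/esym/(connect_no_crossing nc); have := in_setT k; rewrite -rT inE.
by rewrite !vY.
Qed.

(** When [f] joins [p] to [c] and [g] joins [q] to [d], this exchanges the ends [p] and [q], so all
    degrees are kept. *)
Definition swap h f g p q c d k :=
  if k == f then (q, c) else if k == g then (p, d) else h k.

Section Swap.
Variables (h : F -> V * V) (f g : F) (p q c d : V).
Hypotheses (ev : even_graph h) (fg : f != g).
Hypotheses (jf : joins h f p c) (jg : joins h g q d).
Let h' := swap h f g p q c d.

Let gf : (g == f) = false. Proof. by apply/negbTE; rewrite eq_sym. Qed.

Lemma swap_even : even_graph h'.
Proof.
move=> x; rewrite -[RHS](ev x) (bigD1 f) // (bigD1 g) ?gf //=.
rewrite [RHS](bigD1 f) // (bigD1 g) ?gf //= (joins_meets _ jf) (joins_meets _ jg).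
rewrite !addbA; congr addb; last first.
  by apply: eq_bigr => k /andP[/negbTE kf /negbTE kg]; rewrite /meets /h' /swap kf kg.
rewrite /meets /h' /swap eqxx gf eqxx /=.
by rewrite -!addbA; do 4 case: eqP.
Qed.

(** An even graph has no bridge, so the component of [f] stays connected without [f]; both new edges
    have an end in it, and they add [g]. *)
Lemma swap_reach v : f \in reach h v -> g \notin reach h v ->
  #|reach h v| < #|reach h' v|.
Proof.
set X := [set u | connect (link h) v u]; set Y := [set u | connect (link h') v u].
have ncX : no_crossing h X := @no_crossing_component h v.
have ncY : no_crossing h' Y := @no_crossing_component h' v.
have inX k : (k \in reach h v) = ((h k).1 \in X) by rewrite !inE.
have inY k : (k \in reach h' v) = ((h' k).1 \in Y) by rewrite !inE.
rewrite !inX => fX gX.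
have [pX cX] : p \in X /\ c \in X.
  by have := ncX f; rewrite fX; case/orP: jf fX => /eqP-> /= -> <-.
have [qX dX] : q \in X = false /\ d \in X = false.
  by have := ncX g; rewrite (negbTE gX); case/orP: jg (negbTE gX) => /eqP-> /= -> <-.
have oth k : k != f -> k != g -> ((h k).1 \in Y) = ((h k).2 \in Y).
  by move=> /negbTE kf /negbTE kg; have := ncY k; rewrite /h' /swap kf kg.
have qc : (q \in Y) = (c \in Y) by have := ncY f; rewrite /h' /swap eqxx.
have pd : (p \in Y) = (d \in Y) by have := ncY g; rewrite /h' /swap gf eqxx.
(* The other edges of the component of f cross neither X nor Y, and the number
   of edges crossing Y :&: X is even. *)
have pc : (p \in Y) = (c \in Y).
  have := even_cut (Y :&: X) ev; rewrite (bigD1 f) // (bigD1 g) ?gf //= big1.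
    rewrite !in_setI; have -> : ((h g).1 \in X) = false by case/orP: jg => /eqP->.
    have -> : ((h g).2 \in X) = false by case/orP: jg => /eqP->.
    by rewrite !andbF; case/orP: jf => /eqP->; rewrite /= pX cX !andbT; do 2 case: (_ \in Y).
  by move=> k /andP[kf kg]; rewrite !in_setI oth // ncX addbb.
have ncYh : no_crossing h Y.
  move=> k; have [->|kf] := eqVneq k f; first by case/orP: jf => /eqP-> /=.
  have [->|kg] := eqVneq k g; last exact: oth.
  by case/orP: jg => /eqP-> /=; rewrite qc -pd.
have XY u : u \in X -> u \in Y.
  by rewrite inE => /(connect_no_crossing ncYh) <-; rewrite inE connect0.
have pY := XY p pX.
apply/proper_card/properP; split; last first.
  by exists g; rewrite ?inX // inY /h' /swap gf eqxx.
apply/subsetP=> k; rewrite inX inY /h' /swap => /XY.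
by case: eqP => [_|_] //=; [rewrite qc -pc | case: eqP].
Qed.
End Swap.
End Multigraph.

(** * Linear algebra over F_2 *)

Section BooleanMatrices.
Implicit Types I J K : finType.

Definition bit (b : bool) : 'F_2 := (b%:R)%R.

Lemma bitD : {morph bit : a b / a (+) b >-> (a + b)%R}.
Proof. by move=> [] []; apply: val_inj. Qed.

Lemma bitM : {morph bit : a b / a && b >-> (a * b)%R}.
Proof. by move=> [] []; apply: val_inj. Qed.

Lemma bit_inj : injective bit.
Proof. by move=> [] []. Qed.

Lemma bitK (a : 'F_2) : bit (a != 0%R) = a.
Proof. by case: a => [[|[|//]] ?]; apply: val_inj. Qed.

Definition bmx I J (M : I -> J -> bool) : 'M['F_2]_(#|I|, #|J|) :=
  (\matrix_(i, j) bit (M (enum_val i) (enum_val j)))%R.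

Lemma bmxP I J (M N : I -> J -> bool) : bmx M = bmx N -> M =2 N.
Proof.
move=> /matrixP E i j; have := E (enum_rank i) (enum_rank j).
by rewrite !mxE !enum_rankK => /bit_inj.
Qed.

Lemma eq_bmx I J (M N : I -> J -> bool) : M =2 N -> bmx M = bmx N.
Proof. by move=> E; apply/matrixP=> i j; rewrite !mxE E. Qed.

Lemma bmx_surj I J (A : 'M_(#|I|, #|J|)) : exists M : I -> J -> bool, A = bmx M.
Proof.
exists (fun i j => A (enum_rank i) (enum_rank j) != 0%R).
by apply/matrixP=> i j; rewrite !mxE !enum_valK bitK.
Qed.

Lemma bmx0 I J : bmx (fun (_ : I) (_ : J) => false) = 0%R.
Proof. by apply/matrixP=> i j; rewrite !mxE. Qed.

Lemma bmx_mul I J K (M : I -> J -> bool) (N : J -> K -> bool) :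
  (bmx M *m bmx N)%R = bmx (fun i k => \big[addb/false]_j (M i j && N j k)).
Proof.
apply/matrixP=> i k; rewrite !mxE (big_morph _ bitD (erefl : bit false = 0%R)).
rewrite (reindex _ (onW_bij _ (@enum_val_bij J))) /=.
by apply: eq_bigr => j _; rewrite !mxE bitM.
Qed.

Lemma bmx_tr I J (M : I -> J -> bool) : ((bmx M)^T)%R = bmx (fun j i => M i j).
Proof. by apply/matrixP=> i j; rewrite !mxE. Qed.

(** The row space of [M] is the orthogonal complement of its kernel, whose vectors [y] are spanned
    by the columns of the cokernel matrix. *)
Lemma boolean_system I J (M : I -> J -> bool) (p : J -> bool) :
  (forall y : J -> bool, (forall i, \big[addb/false]_j (M i j && y j) = false) ->
    \big[addb/false]_j (p j && y j) = false) ->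
  exists s : I -> bool, forall j, \big[addb/false]_i (s i && M i j) = p j.
Proof.
move=> orth; pose P := bmx (fun (_ : unit) => p).
have [C defC] := bmx_surj (cokermx (bmx M)).
have /submxP[D] : (P <= bmx M)%MS.
  rewrite submxE defC bmx_mul -bmx0; apply/eqP/eq_bmx => _ k; apply: orth => i.
  have := mulmx_coker (bmx M); rewrite defC bmx_mul -bmx0 => /bmxP E.
  exact: (E i k).
have [s ->] := bmx_surj D; rewrite bmx_mul => /bmxP E.
by exists (s tt) => j; rewrite -(E tt j).
Qed.

Definition constant_kernel I J (M : I -> J -> bool) :=
  forall y : I -> bool, (forall j, \big[addb/false]_i (y i && M i j) = false) ->
    forall i i', y i = y i'.

(** All rows of the kernel matrix are constant, so it is a column times a row of ones and has rank
    at most 1. *)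
Lemma rank_constant_kernel I J (M : I -> J -> bool) :
  constant_kernel M -> #|I| <= (\rank (bmx M)).+1.
Proof.
move=> ck; have [i0 _|I0] := pickP (mem I); last by rewrite (leq_trans (_ : _ <= 0)) ?eq_card0.
suff: \rank (kermx (bmx M)) <= 1 by rewrite mxrank_ker leq_subLR addn1.
have [K defK] := bmx_surj (kermx (bmx M)).
have Kc i j j' : K i j = K i j'.
  apply: (ck (K i)) => k; have := mulmx_ker (bmx M).
  by rewrite defK bmx_mul -bmx0 => /bmxP E; exact: (E i k).
have -> : kermx (bmx M) = ((\col_i bit (K (enum_val i) i0)) *m const_mx 1)%R :> 'M_(#|I|).
  apply/matrixP=> i j; rewrite defK !mxE big_ord1 !mxE GRing.mulr1.
  by rewrite (Kc _ i0 (enum_val j)).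
by apply: leq_trans (mxrankM_maxr _ _) _; rewrite rank_leq_row.
Qed.

(** Exactness at [J] by dimension: [M] has rank at least [#|I| - 1], the kernel of [N] has dimension
    at most [#|J| - #|K| + 1], and the Euler relation makes these bounds equal. *)
Lemma boolean_exact I J K (M : I -> J -> bool) (N : J -> K -> bool) :
  constant_kernel M -> constant_kernel (fun k j => N j k) ->
  #|K| + #|I| = #|J| + 2 ->
  (forall i k, \big[addb/false]_j (M i j && N j k) = false) ->
  forall c : J -> bool, (forall k, \big[addb/false]_j (c j && N j k) = false) ->
  exists s : I -> bool, forall j, \big[addb/false]_i (s i && M i j) = c j.
Proof.
move=> kM kN euler MN c cN.
have rM := rank_constant_kernel kM.
have rN : #|K| <= (\rank (bmx N)).+1.
  by rewrite -mxrank_tr bmx_tr; apply: rank_constant_kernel.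
have sub : (bmx M <= kermx (bmx N))%MS.
  by rewrite sub_kermx bmx_mul -bmx0; apply/eqP/eq_bmx.
have [_] := mxrank_leqif_sup sub; rewrite eqn_leq (mxrankS sub) /= => full.
have {}full : (kermx (bmx N) <= bmx M)%MS.
  rewrite -full mxrank_ker leq_subLR -(leq_add2r 2) -euler.
  by apply: leq_trans (leq_add rN rM) _; rewrite addSn addnS addn2.
have : (bmx (fun (_ : unit) => c) <= bmx M)%MS.
  apply: submx_trans full; rewrite sub_kermx bmx_mul -bmx0.
  by apply/eqP/eq_bmx => _ k; exact: cN.
case/submxP=> D; have [s ->] := bmx_surj D; rewrite bmx_mul => /bmxP E.
by exists (s tt) => j; rewrite -(E tt j).
Qed.
End BooleanMatrices.

(** * Faces of a plane graph *)

Section Faces.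
Variable G : plane_graph.
Implicit Types (x y : dart G) (u v w : G) (F : face G).

Local Notation rot := (rotation G).
Local Notation phi := (face_perm rot).
Local Notation rev := (@rev_dart G).

Lemma phiE x : phi x = rot (rev x).
Proof. by rewrite permM permE. Qed.

Lemma rotE x : rot x = phi (rev x).
Proof. by rewrite phiE rev_dartK. Qed.

Lemma src_rev x : src (rev x) = tgt x. Proof. by []. Qed.
Lemma tgt_rev x : tgt (rev x) = src x. Proof. by []. Qed.

Lemma src_rot x : src (rot x) = src x.
Proof.
have := mem_porbit rot 1 x; rewrite expg1 (rotationP (p:=G)).
by rewrite inE => /eqP.
Qed.

Lemma same_src x y : src x = src y -> exists i, y = iter i rot x.
Proof.
move=> E; have : y \in porbit rot x by rewrite (rotationP (p:=G)) inE E.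
by case/porbitP=> i ->; exists i; rewrite permX.
Qed.

Lemma src_phi x : src (phi x) = tgt x.
Proof. by rewrite phiE src_rot. Qed.

Lemma adj_dart x : adj (src x) (tgt x). Proof. exact: (valP x). Qed.

Lemma src_neq_tgt x : src x != tgt x.
Proof. by apply: contraTneq (adj_dart x) => ->; rewrite adj_irr. Qed.

Lemma dart_of_adj u w : adj u w -> exists x, src x = u /\ tgt x = w.
Proof. by move=> uw; exists (exist (fun p : G * G => adj p.1 p.2) (u, w) uw). Qed.

Lemma dart_eq x y : src x = src y -> tgt x = tgt y -> x = y.
Proof.
by rewrite /src /tgt => E E'; apply: val_inj; rewrite (surjective_pairing (val x)) E E' -surjective_pairing.
Qed.

Lemma rev_neq x : rev x != x.
Proof. by apply/eqP=> E; have := src_neq_tgt x; rewrite -src_rev E eqxx. Qed.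

Fact face_of_subproof x : porbit phi x \in porbits phi.
Proof. exact: imset_f. Qed.

Definition face_of x : face G :=
  exist (fun S : {set dart G} => S \in porbits phi) (porbit phi x) (face_of_subproof x).

Lemma in_face x F : (x \in val F) = (face_of x == F).
Proof.
case: F => S porbS; rewrite -val_eqE /=; case/imsetP: porbS => y _ ->.
by rewrite eq_porbit_mem.
Qed.

Lemma face_of_phi x : face_of (phi x) = face_of x.
Proof. by apply/eqP; rewrite -in_face /= -{1}[phi]expg1 mem_porbit. Qed.

Lemma face_of_rot x : face_of (rot x) = face_of (rev x).
Proof. by rewrite rotE face_of_phi. Qed.

Lemma face_of_surj F : exists x, face_of x = F.
Proof.
case: F => S porbS; case/imsetP: (porbS) => y _ E.
by exists y; apply: val_inj; rewrite /= E.
Qed.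

Lemma same_face x y : face_of x = face_of y -> exists i, y = iter i phi x.
Proof.
move=> /esym/eqP; rewrite -in_face => /porbitP[i ->].
by exists i; rewrite permX.
Qed.

Lemma incidentP u F : reflect (exists x, face_of x = F /\ src x = u) (incident u F).
Proof.
apply: (iffP existsP) => [[x]|[x [<- <-]]]; last by exists x; rewrite in_face !eqxx.
by rewrite in_face => /andP[/eqP E /eqP E']; exists x.
Qed.

Lemma incident_src x : incident (src x) (face_of x).
Proof. by apply/incidentP; exists x. Qed.

Lemma incident_tgt x : incident (tgt x) (face_of x).
Proof. by rewrite -src_phi -face_of_phi incident_src. Qed.

(** Rotation reaches every dart at a vertex and reversal passes to a neighbour, so the value of [b]
    is carried along any path avoiding [X]. *)
Lemma invariant_constant (A : Type) (X : {set G}) (b : dart G -> A) :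
  connected_off X -> (forall x, b (rev x) = b x) ->
  (forall x, src x \notin X -> b (rot x) = b x) ->
  forall x y, src x \notin X -> src y \notin X -> b x = b y.
Proof.
move=> con brev brot.
have bsrc x y : src x \notin X -> src x = src y -> b x = b y.
  move=> xX /same_src[i ->]; elim: i => //= i ->; rewrite brot //.
  by elim: i => //= i; rewrite src_rot.
move=> x y xX yX; have /connectP[s] := con _ _ xX yX.
elim: s x xX => [|w s IHs] x xX /=; first by move=> _ E; apply: bsrc.
case/andP=> /and3P[/dart_of_adj[z [zx zw]] _ wX] sp E.
rewrite (@bsrc x z) // -brev; apply: IHs; rewrite ?src_rev ?zw //.
Qed.

(** * Edges and the first homology mod 2 *)

Definition edge := {e : {set G} | e \in edges G}.

Fact edge_of_subproof x : [set src x; tgt x] \in edges G.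
Proof. by apply/imsetP; exists (val x) => //; rewrite inE adj_dart. Qed.

Definition edge_of x : edge := exist (fun e => e \in edges G) _ (edge_of_subproof x).

Lemma edge_of_eq x y : (edge_of y == edge_of x) = (y == x) || (y == rev x).
Proof.
apply/idP/orP => [|[/eqP->|/eqP->]//]; last by rewrite -val_eqE /= setUC.
rewrite -val_eqE /= => /eqP E.
have := set21 (src y) (tgt y); have := set22 (src y) (tgt y); rewrite E !inE.
have := src_neq_tgt y => + /orP[] /eqP t /orP[] /eqP s; rewrite s t ?eqxx // => _.
  by right; apply/eqP/dart_eq.
by left; apply/eqP/dart_eq.
Qed.

Lemma big_dart_edge x (b : dart G -> bool) :
  \big[addb/false]_y (b y && (edge_of y == edge_of x)) = b x (+) b (rev x).
Proof.
rewrite (bigD1 x) // (bigD1 (rev x)) ?rev_neq //= big1 => [|y /andP[yx yr]].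
  by rewrite !edge_of_eq !eqxx orbT !andbT addbF.
by rewrite edge_of_eq (negbTE yx) (negbTE yr) andbF.
Qed.

(** The boundary at [u] of the chain of edges of [b] is determined by the places where [b] changes
    along facial walks. *)
Lemma big_edge_vertex u (b : dart G -> bool) :
  \big[addb/false]_e ((\big[addb/false]_x (b x && (edge_of x == e))) && (u \in val e))
  = \big[addb/false]_x ((b x (+) b (phi x)) && (src (phi x) == u)).
Proof.
transitivity (\big[addb/false]_x (b x && ((src x == u) (+) (src (phi x) == u)))).
  under eq_bigr do rewrite big_distrl.
  rewrite exchange_big; apply: eq_bigr => x _ /=.
  rewrite (bigD1 (edge_of x)) //= eqxx big1 => [|e /negbTE ne].
    rewrite andbT addbF !inE src_phi !(eq_sym u).
    have := src_neq_tgt x; case: (b x) => //=.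
    by case: (eqVneq (src x) u) => [->|//]; rewrite eq_sym => /negbTE->.
  by rewrite eq_sym ne andbF.
under eq_bigr do rewrite andb_addr.
under [RHS]eq_bigr do rewrite andb_addl.
rewrite !big_split /= [RHS]addbC; congr addb.
by rewrite (reindex_inj (@perm_inj _ phi)).
Qed.

Lemma big_face_edge (s : face G -> bool) (e : edge) :
  \big[addb/false]_F (s F && \big[addb/false]_x ((face_of x == F) && (edge_of x == e)))
  = \big[addb/false]_x (s (face_of x) && (edge_of x == e)).
Proof.
under eq_bigr do rewrite big_distrr.
rewrite exchange_big; apply: eq_bigr => x _ /=.
rewrite (bigD1 (face_of x)) //= eqxx big1 ?addbF // => F /negbTE nF.
by rewrite eq_sym nF andbF.
Qed.

Lemma connected0 : connected_off (set0 : {set G}).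
Proof. exact: plane_connected. Qed.

Lemma potential_constant (A : Type) (y : G -> A) :
  (forall x, y (src x) = y (tgt x)) -> forall u w, y u = y w.
Proof.
move=> inv u w; have n0 u' : u' \notin (set0 : {set G}) by rewrite inE.
have /connectP[s + ->] := connected0 (n0 u) (n0 w).
elim: s u => //= a s IHs u /andP[/and3P[/dart_of_adj[x [xu xa]] _ _] /IHs <-].
by rewrite -xu -xa.
Qed.

(* On the sphere every 1-cycle mod 2 bounds a set of faces; the 1-chain here is
   the sum of the edges of the darts in W. *)
Lemma cycle_boundary (W : dart G -> bool) :
  (forall u, \big[addb/false]_x ((W x (+) W (phi x)) && (src (phi x) == u)) = false) ->
  exists s : face G -> bool,
    forall x, s (face_of x) (+) s (face_of (rev x)) = W x (+) W (rev x).
Proof.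
move=> cW.
(* The boundary maps from faces to edges and from edges to vertices; an edge with one face on both
   sides contributes zero to [M]. *)
pose M F (e : edge) := \big[addb/false]_x ((face_of x == F) && (edge_of x == e)).
pose N (e : edge) u := u \in val e.
have kM : constant_kernel M.
  move=> y kery F F'; have [[x <-] [x' <-]] := (face_of_surj F, face_of_surj F').
  apply: (@invariant_constant _ set0 (fun x => y (face_of x))); rewrite ?inE //.
  - exact: connected0.
  - move=> z; have := kery (edge_of z); rewrite big_face_edge big_dart_edge.
    by case: (y _); case: (y _).
  - move=> z _; rewrite face_of_rot.
    have := kery (edge_of z); rewrite big_face_edge big_dart_edge.
    by case: (y _); case: (y _).
have kN : constant_kernel (fun u e => N e u).
  move=> y kery; apply: potential_constant => x.
  have := kery (edge_of x); rewrite /N (bigD1 (src x)) // (bigD1 (tgt x)) 1?eq_sym ?src_neq_tgt //=.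
  rewrite !inE !eqxx orbT !andbT big1 => [|w /andP[/negbTE w1 /negbTE w2]].
    by case: (y _); case: (y _).
  by rewrite !inE w1 w2 andbF.
have MN F u : \big[addb/false]_e (M F e && N e u) = false.
  rewrite /M /N big_edge_vertex big1 // => x _.
  by rewrite face_of_phi addbb.
have euler : #|G| + #|{: face G}| = #|{: edge}| + 2.
  by rewrite !card_sig -plane_euler.
pose c e := \big[addb/false]_x (W x && (edge_of x == e)).
have cN u : \big[addb/false]_e (c e && N e u) = false.
  by rewrite /c /N big_edge_vertex cW.
have [s sM] := boolean_exact kM kN euler MN cN.
exists s => x; have := sM (edge_of x).
by rewrite /M big_face_edge /c !big_dart_edge.
Qed.

(** If a face visited a vertex at [x] and again at [y], the stretch [W] of its walk between them
    would be closed, hence bound a set [s] of faces. The sum of [W] and [s] is invariant away from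
    that vertex, so constant, but it separates [x] from [y]. *)
Lemma face_simple x y : connected_off [set src x] ->
  face_of x = face_of y -> src x = src y -> x = y.
Proof.
move=> con fxy sxy; apply/eqP/negPn/negP => xy.
have ex : exists k, y == iter k phi x by have [k ->] := same_face fxy; exists k.
case: (ex_minnP ex) => k /eqP yk mink.
have k0 : 0 < k by case: k yk {mink} => // yx; rewrite yx eqxx in xy.
pose W z := z \in traject phi x k.
have Wx : W x by rewrite /W; case: k k0 {yk mink W} => //= k _; rewrite mem_head.
have Wy : W y = false.
  apply/negbTE/negP => /trajectP[i ik yi].
  by have := mink i; rewrite -yi eqxx leqNgt ik => /(_ isT).
have nback i : i < k -> iter i.+1 phi x != x.
  move=> ik; apply/eqP=> E; have := mink (k - i.+1).
  have -> : y = iter (k - i.+1) phi x by rewrite -{1}E -iterD subnK.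
  by rewrite eqxx leqNgt -subSn // subSS leq_subr => /(_ isT).
have shift z : W z (+) W (phi z) = (phi z == x) (+) (phi z == y).
  (* The trajectory with [k.+1] terms is split in two ways: its first term [x] and the rest, or [W]
     and its last term [y]. *)
  have : phi z \in traject phi x k.+1 = (phi z \in traject phi x k.+1) by [].
  rewrite {1}trajectS trajectSr mem_rcons !in_cons -yk.
  have -> : (phi z \in traject phi (phi x) k) = W z.
    apply/trajectP/trajectP => -[i ik].
      by rewrite -iterSr iterS => /perm_inj ->; exists i.
    by move=> ->; exists i => //; rewrite -iterSr.
  rewrite -/(W (phi z)); have [px|px] := eqVneq (phi z) x.
    have -> : W z = false.
      apply/negbTE/negP => /trajectP[i ik zi].
      by have := nback i ik; rewrite iterS -zi px eqxx.
    by rewrite px Wx (negbTE xy).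
  have [->|] /= := eqVneq (phi z) y; last by move=> _ ->; rewrite addbb.
  by rewrite Wy => ->.
have [u|s sW] := @cycle_boundary W.
  under eq_bigr do rewrite shift.
  rewrite (reindex_inj (@perm_inj _ (phi^-1)%g)) /=.
  under eq_bigr do rewrite permKV andb_addl.
  rewrite big_split /= (bigD1 x) //= eqxx big1 => [|z /negbTE->//].
  by rewrite (bigD1 y) //= eqxx big1 => [|z /negbTE->//]; rewrite sxy !addbF addbb.
pose b z := W z (+) s (face_of z).
have brev z : b (rev z) = b z.
  by have := sW z; rewrite /b; case: (W z); case: (W (rev z)); case: (s _); case: (s _).
have brot z : src z \notin [set src x] -> b (rot z) = b z.
  rewrite inE -(brev z) => zx; rewrite /b face_of_rot rotE; congr addb.
  have := shift (rev z); rewrite -rotE.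
  have nz z' : src z' = src x -> (rot z == z') = false.
    by move=> E; apply/negbTE; apply: contra zx => /eqP E'; rewrite -src_rot E' E.
  by rewrite !nz //; case: (W _); case: (W _).
(* Both [x] and [y] start at the deleted vertex, so their reverses are compared. *)
have rX z : src z = src x -> src (rev z) \notin [set src x].
  by move=> <-; rewrite inE eq_sym src_neq_tgt.
have := invariant_constant con brev brot (rX x erefl) (rX y (esym sxy)).
by rewrite !brev /b Wx Wy fxy; case: (s _).
Qed.

End Faces.

(** * Triangles of a tight graph *)

Section Tight.
Variable G : plane_graph.
Hypothesis hG : tight G.
Implicit Types (x y : dart G) (u v w : G) (F : face G).

Local Notation rot := (rotation G).
Local Notation phi := (face_perm rot).
Local Notation rev := (@rev_dart G).
Local Notation tri x := (triangular (face_of x)).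

Lemma connected_off_lt3 (X : {set G}) : #|X| < 3 -> connected_off X.
Proof. by case: hG => -[_ con _]; apply: con. Qed.

(** Tightness puts both darts in one face, which visits the vertex only once. *)
Lemma nontriangular_corner x y :
  ~~ tri x -> ~~ tri y -> src x = src y -> x = y.
Proof.
move=> nx ny sxy; apply: (face_simple _ _ sxy).
  by apply: connected_off_lt3; rewrite cards1.
apply/eqP/negPn/negP => fxy; case: hG => _ disj.
have := disj _ _ _ _ fxy (src x); rewrite !inE => /(_ nx ny).
by rewrite incident_src sxy incident_src.
Qed.

(** Minimum degree 3: deleting the other ends of [x] and [y] cannot isolate their common origin. *)
Lemma third_dart x y : src x = src y -> exists z, [/\ src z = src x, z <> x & z <> y].
Proof.
move=> sxy; pose X := [set tgt x; tgt y].
have uX : src x \notin X.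
  by rewrite !inE negb_or src_neq_tgt sxy src_neq_tgt.
have /existsP[w] : [exists w, w \notin src x |: X].
  apply: contraT => /existsPn all; case: hG => -[card _] _.
  have : #|G| <= #|src x |: X|.
    by apply/subset_leq_card/subsetP => w _; apply: contraT => /(negP (all w)).
  by rewrite cardsU1 uX cards2 leqNgt; case: (_ != _); rewrite ?(ltnW card) ?card.
rewrite in_setU1 negb_or => /andP[wx wX].
have /connectP[[|z s] /= +] : connect [rel a b | [&& adj a b, a \notin X & b \notin X]] (src x) w.
    by apply: connected_off_lt3 => //; rewrite cards2; case: (_ != _).
  by move=> _ E; rewrite E eqxx in wx.
case/andP=> /and3P[/dart_of_adj[d [dx dz]] _ zX] _ _; exists d; split=> // E.
  by move: zX; rewrite -dz E !inE eqxx.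
by move: zX; rewrite -dz E !inE eqxx orbT.
Qed.

Lemma rot_neq x : rot x != x.
Proof.
apply/eqP=> E; have [z [/esym/same_src[i ->] ne _]] := third_dart (erefl (src x)).
by apply: ne; elim: i => //= i ->.
Qed.

Lemma rot2_neq x : rot (rot x) != x.
Proof.
apply/eqP=> E; have [z [/esym/same_src[i ->] ne ne']] := third_dart (esym (src_rot x)).
have : iter i rot x = x \/ iter i rot x = rot x by elim: i {ne ne'} => [|i []] /= => [|->|->]; auto.
by case.
Qed.

Lemma triangular_rot x : tri x || tri (rot x).
Proof.
apply: contraT; rewrite negb_or => /andP[nx nr].
by have /eqP := nontriangular_corner nr nx (src_rot x); rewrite (negbTE (rot_neq x)).
Qed.

Lemma triangular_rev x : tri x || tri (rev x).
Proof. by rewrite -face_of_rot triangular_rot. Qed.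

(** The faces beyond two consecutive edges have corners at their common vertex. If both were
    nontriangular, these corners would coincide and the vertex would have degree 2. *)
Lemma triangular_neighbour x : tri (rev x) || tri (rev (phi x)).
Proof.
apply: contraT; rewrite negb_or -(face_of_rot (phi x)) => /andP[nx nr].
have := nontriangular_corner nr nx; rewrite src_rot src_phi => /(_ erefl) E.
by have := rot2_neq (phi x); rewrite E -phiE eqxx.
Qed.

Lemma vertex_invariant (P : face G -> bool) :
  (forall x, tri x -> tri (rev x) -> P (face_of x) = P (face_of (rev x))) ->
  forall x y, tri x -> tri y -> src x = src y -> P (face_of x) = P (face_of y).
Proof.
move=> Padj.
have step z : tri z -> tri (rot z) -> P (face_of (rot z)) = P (face_of z).
  by rewrite face_of_rot => tz tr; rewrite -Padj.
move=> x y tx ty sxy.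
have [/existsP[y0 /andP[n0 /eqP s0]]|/existsPn all] :=
  boolP [exists y0, ~~ tri y0 && (src y0 == src x)].
  (* The nontriangular corner breaks the cyclic order at the vertex into a path. *)
  have claim i : tri (iter i rot y0) -> P (face_of (iter i rot y0)) = P (face_of (rot y0)).
    elim: i => [|i IHi] /=; first by rewrite (negbTE n0).
    have [ti|ni] := boolP (tri (iter i rot y0)); first by move=> tr; rewrite step ?IHi.
    rewrite (nontriangular_corner ni n0) //.
    by elim: (i) => //= j; rewrite src_rot.
  have [i Ex] := same_src s0; have [j Ey] := same_src (etrans s0 sxy).
  by rewrite Ex Ey in tx ty *; rewrite !claim.
have [i ->] := same_src sxy; elim: i => //= i ->.
have sr j : src (iter j rot x) = src x by elim: j => //= j; rewrite src_rot.
have tr j : tri (iter j rot x).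
  by have := all (iter j rot x); rewrite sr eqxx andbT negbK.
by rewrite [RHS]step ?(tr i) //; exact: (tr i.+1).
Qed.

Lemma triangles_connected (P : face G -> bool) :
  (forall x, tri x -> tri (rev x) -> P (face_of x) = P (face_of (rev x))) ->
  forall x y, tri x -> tri y -> P (face_of x) = P (face_of y).
Proof.
move=> Padj; have vert := vertex_invariant Padj.
(* The common value of [P] on the triangles around the origin of [x]. It passes along edges, since
   every edge lies on a triangle, which contains both its ends. *)
pose b x := if tri x then P (face_of x) else P (face_of (rot x)).
have bE x y : tri y -> src x = src y -> b x = P (face_of y).
  move=> ty sxy; rewrite /b; case: ifP => [tx|nx]; first exact: vert.
  by apply: vert; rewrite ?src_rot //; have := triangular_rot x; rewrite nx.
have brot x : b (rot x) = b x.
  have sx := src_rot x; have [tx|] := boolP (tri x); first by rewrite !(@bE _ x).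
  by have := triangular_rot x => /orP[->//|tr _]; rewrite !(@bE _ (rot x)).
have brev_tri x : tri x -> b (rev x) = b x.
  move=> tx; rewrite (@bE x x) // (@bE (rev x) (phi x)) ?face_of_phi //.
  by rewrite src_phi.
have brev x : b (rev x) = b x.
  by have /orP[/brev_tri//|/brev_tri] := triangular_rev x; rewrite rev_dartK.
move=> x y tx ty; rewrite -(@bE x x) // -(@bE y y) //.
by apply: (invariant_constant (@connected0 G)); rewrite ?inE.
Qed.

Lemma phi3 x : tri x -> phi (phi (phi x)) = x.
Proof.
move=> /eqP tx; have := iter_porbit phi x.
by rewrite -[porbit _ _]/(val (face_of x)) tx.
Qed.

Lemma triangle_darts x y : tri x -> face_of x = face_of y ->
  [\/ y = x, y = phi x | y = phi (phi x)].
Proof.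
move=> tx /same_face[i ->]; elim: i => [|i [] /= ->]; rewrite ?(phi3 tx);
  by [left|right; left|right; right|constructor 2|constructor 3|constructor 1].
Qed.

Lemma phi_neq x : phi x != x.
Proof. by apply/eqP=> E; have := src_neq_tgt x; rewrite -src_phi E eqxx. Qed.

Lemma triangle_vertices x u : tri x -> incident u (face_of x) ->
  [\/ u = src x, u = tgt x | u = src (phi (phi x))].
Proof.
move=> tx /incidentP[y [/esym/(triangle_darts tx)[]-> <-]].
- by constructor 1.
- by constructor 2; rewrite src_phi.
- by constructor 3.
Qed.

Definition uncrossed (Y : {set G}) x := (src x \in Y) == (tgt x \in Y).

Lemma uncrossed_rev Y x : uncrossed Y (rev x) = uncrossed Y x.
Proof. exact: eq_sym. Qed.

Lemma uncrossed_triangle Y x y z : tri x -> face_of x = face_of y -> y != x ->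
  uncrossed Y x -> uncrossed Y y -> face_of x = face_of z -> uncrossed Y z.
Proof.
move=> tx fxy yx ux uy fxz; move: yx uy ux.
have := src_phi (phi (phi x)); rewrite phi3 // => E.
case: (triangle_darts tx fxy) => ->; rewrite ?eqxx //;
case: (triangle_darts tx fxz) => -> //; rewrite /uncrossed -!E -!src_phi; 
 by do 3 case: (src _ \in Y).
Qed.
End Tight.

(** * Spanning choices of one edge per triangle *)

Section Spanning.
Variable G : plane_graph.
Hypothesis hG : tight G.
Implicit Types (x y : dart G) (u v w : G) (F : face G).

Local Notation rot := (rotation G).
Local Notation phi := (face_perm rot).
Local Notation rev := (@rev_dart G).
Local Notation tri x := (triangular (face_of x)).

(** Cuts express that the chosen edges connect the ends of every edge of a face in [A]. *)
Definition spans (A : {set face G}) (z : face G -> dart G) :=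
  (forall F, F \in A -> triangular F /\ face_of (z F) = F) /\
  forall Y : {set G}, (forall F, F \in A -> uncrossed Y (z F)) ->
    forall x, face_of x \in A -> uncrossed Y x.

(** The new triangle takes an edge other than the one shared with [A]. A cut that avoids both avoids
    its third edge as well. *)
Lemma spans_extend (A : {set face G}) z x :
  spans A z -> face_of x \in A -> face_of (rev x) \notin A -> tri (rev x) ->
  exists z', spans (face_of (rev x) |: A) z'.
Proof.
move=> [zA spA] xA rA tr; pose t := face_of (rev x).
exists (fun F => if F == t then phi (rev x) else z F); split=> [F|Y unY y].
  rewrite in_setU1; case: eqP => [-> _|_ /zA//]; by rewrite face_of_phi.
have unA x' : face_of x' \in A -> uncrossed Y x'.
  apply: spA => F FA; have := unY F; rewrite in_setU1 FA orbT => /(_ isT).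
  by case: eqP => // E; rewrite /t E in FA *; rewrite FA in rA.
rewrite in_setU1 => /orP[/eqP Ey|/unA//].
have := unY t; rewrite in_setU1 !eqxx => /(_ isT) un1.
apply: (uncrossed_triangle tr _ (phi_neq (rev x)) _ un1); rewrite ?face_of_phi //.
by rewrite uncrossed_rev unA.
Qed.

Lemma next_triangle x : tri x -> tri (rev x) ->
  exists y, [/\ face_of y = face_of (rev x), y != rev x & tri (rev y)].
Proof.
move=> tx tr; have /orP[t1|t2] := triangular_neighbour hG (phi (rev x)).
  by exists (phi (rev x)); rewrite face_of_phi phi_neq.
exists (phi (phi (rev x))); rewrite !face_of_phi; split=> //.
by apply/eqP=> E; have := phi_neq (rev x); rewrite -{1}E phi3 ?eqxx.
Qed.

(* A shortest closed walk in the dual graph through triangles only, without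
   immediate backtracking, crosses one edge of each of its triangles. *)
Lemma spans_cycle : exists A z, spans A z /\ exists x, face_of x \in A.
Proof.
pose good x := tri x && tri (rev x).
have [x0 g0] : exists x0, good x0.
  have [x tx] : exists x, tri x.
    have [x _|G0] := pickP (@predT (dart G)).
      by have /orP[] := triangular_rev hG x; [exists x|exists (rev x)].
    have /card_gt1P[u [w [_ _ uw]]] : 1 < #|G|.
      by case: hG => -[card _] _; apply: leq_trans card.
    have n0 a : a \notin (set0 : {set G}) by rewrite inE.
    have /connectP[[|a s] /=] := connected0 (n0 u) (n0 w).
      by move=> _ E; rewrite E eqxx in uw.
    by case/andP=> /and3P[/dart_of_adj[x _]]; have := G0 x.
  have /orP[tr|tr] := triangular_neighbour hG x; first by exists x; rewrite /good tx.
  by exists (phi x); rewrite /good face_of_phi tx.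
have nextP x : exists y, good x ==>
    [&& good y, face_of y == face_of (rev x) & y != rev x].
  have [/andP[tx tr]|_] := boolP (good x); last by exists x.
  have [y [fy ny ty]] := next_triangle tx tr; exists y.
  by rewrite /good fy tr ty eqxx ny.
pose next x := xchoose (nextP x).
have nextE x : good x ->
    [/\ good (next x), face_of (next x) = face_of (rev x) & next x != rev x].
  by move=> gx; have /implyP/(_ gx)/and3P[? /eqP] := xchooseP (nextP x).
(* The walk leaves its triangle [f l] through the dart [X l]. *)
pose X l := iter l next x0; pose f l := face_of (X l).
have gX l : good (X l) by elim: l => //= l /nextE[].
have fS l : f l.+1 = face_of (rev (X l)) by have [] := nextE _ (gX l).
have XS l : X l.+1 != rev (X l) by have [] := nextE _ (gX l).
(* At the least such [j] a triangle recurs for the first time, so those before it are distinct. *)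
have ex : exists j, [exists i : 'I_j, f i == f j].
  have /(uniqPn (f 0))[i [j [ij js E]]] : ~~ uniq (mkseq f #|{: face G}|.+1).
    apply/negP => /card_uniqP; rewrite size_mkseq => E.
    by have := max_card (mem (mkseq f #|{: face G}|.+1)); rewrite E ltnn.
  rewrite size_mkseq in js; rewrite !nth_mkseq ?(ltn_trans ij) // in E.
  by exists j; apply/existsP; exists (Ordinal ij); rewrite E.
case: (ex_minnP ex) => j /existsP[i' /eqP fij] minj.
have {i' fij} [i [ij fij]] : exists i, i < j /\ f i = f j by exists i'.
have jS : j.-1.+1 = j by rewrite prednK // (leq_ltn_trans _ ij).
have inj k l : k < j -> l < j -> f k = f l -> k = l.
  have ne a b : a < b -> b < j -> f a <> f b.
    move=> ab bj E; suff /minj : [exists k : 'I_b, f k == f b] by rewrite leqNgt bj.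
    by apply/existsP; exists (Ordinal ab); rewrite E.
  move=> kj lj E; case: (ltngtP k l) => // kl; first by case: (ne _ _ kl lj).
  by case: (ne _ _ kl kj).
pose A := [set f l | l : 'I_j & i <= l].
pose z F := if [pick l : 'I_j | (i <= l) && (f l == F)] is Some l then X l else x0.
have zX l : i <= l -> l < j -> z (f l) = X l.
  move=> il lj; rewrite /z; case: pickP => [k /andP[_ /eqP/inj E]|/(_ (Ordinal lj))].
    by rewrite /= E.
  by rewrite /= il eqxx.
exists A, z; split; last first.
  by exists (X i); apply/imsetP; exists (Ordinal ij); rewrite ?inE /=.
split=> [F /imsetP[l]|Y unY x /imsetP[l]]; rewrite inE => il E.
  by rewrite E zX //; have /andP[] := gX l.
have unX k : i <= k -> k < j -> uncrossed Y (X k).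
  move=> ik kj; rewrite -zX // unY //; apply/imsetP.
  by exists (Ordinal kj); rewrite ?inE.
have tl : tri (X l) by have /andP[] := gX l.
(* Each triangle of the cycle also has the edge shared with its predecessor; that of [f i] is
   [f j.-1]. *)
have [k [ik kj fk nk]] : exists k, [/\ i <= k, k < j, face_of (rev (X k)) = f l & rev (X k) != X l].
  move: il; rewrite leq_eqVlt => /orP[/eqP il|].
    exists j.-1; rewrite -fS jS -il -fij -ltnS jS ij; split=> //.
    apply/eqP=> E'; have := ij; rewrite -{1}jS ltnS leq_eqVlt => /orP[/eqP ij'|ij'].
      by move: E'; rewrite ij' => /eqP; rewrite (negbTE (rev_neq _)).
    (* If the two edges coincided, the cycle would have length two and the walk would have turned
       back. *)
    have E2 : X j.-1 = rev (X i) by rewrite -E' rev_dartK.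
    have i1j : i.+1 < j by rewrite -jS ltnS.
    have j1j : j.-1 < j by rewrite -{2}jS.
    have E3 := inj _ _ i1j j1j (etrans (fS i) (congr1 (@face_of G) (esym E2))).
    by have := XS i; rewrite E3 -E2 eqxx.
  case: (nat_of_ord l) (ltn_ord l) => // k kj ik; exists k.
  by rewrite (ltnW kj) -fS eq_sym XS; split.
apply: (uncrossed_triangle tl _ nk) => //.
- exact: unX.
- by rewrite uncrossed_rev unX.
Qed.
End Spanning.

(** * Connected even selections *)

Section Selection.
Variable G : plane_graph.
Hypothesis hG : tight G.
Implicit Types (x y : dart G) (u v w : G) (F : face G).

Local Notation rot := (rotation G).
Local Notation phi := (face_perm rot).
Local Notation rev := (@rev_dart G).
Local Notation tri x := (triangular (face_of x)).

(** Extension across edges between triangles stops only when [A] contains all triangles, as these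
    are connected in the dual graph. *)
Lemma spans_triangles : exists z, spans [set F : face G | triangular F] z.
Proof.
have [A [z [spA A0]]] := spans_cycle hG.
have [n] := ubnP #|~: A|; elim: n A z spA A0 => // n IHn A z spA [a aA] ltn.
have triA F : F \in A -> triangular F by move=> FA; have [/(_ _ FA)[]] := spA.
have [/existsP[x /and3P[xA xr rA]]|/existsPn none] :=
  boolP [exists x, [&& face_of x \in A, tri (rev x) & face_of (rev x) \notin A]].
  have [z' spA'] := spans_extend spA xA rA xr.
  apply: IHn spA' _ _; first by exists a; rewrite in_setU1 aA orbT.
  rewrite -ltnS; apply: leq_trans ltn; rewrite ltnS; apply: proper_card.
  rewrite properC; apply/properP; split; first exact: subsetUr.
  by exists (face_of (rev x)); rewrite ?in_setU1 ?eqxx.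
have half x : tri (rev x) -> face_of x \in A -> face_of (rev x) \in A.
  by move=> xr xA; have := none x; rewrite xA xr /= negbK.
have adjA x : tri x -> tri (rev x) -> (face_of x \in A) = (face_of (rev x) \in A).
  move=> tx xr; apply/idP/idP; first exact: half.
  by rewrite -{2}[x]rev_dartK; apply: half; rewrite ?rev_dartK.
have -> : [set F : face G | triangular F] = A; last by exists z.
apply/setP=> F; rewrite inE; apply/idP/idP => [|/triA//].
have [x <-] := face_of_surj F => tx.
by have := triangles_connected (P := fun F => F \in A) hG adjA (triA _ aA) tx => <-.
Qed.

Definition valid (wanted : face G -> G * G) (h : face G -> G * G) :=
  forall F, [/\ (h F).1 != (h F).2, incident (h F).1 F, incident (h F).2 F &
    ~~ triangular F -> h F = wanted F].

Lemma even_selection wanted :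
  (forall F, ~~ triangular F -> [/\ (wanted F).1 != (wanted F).2,
    incident (wanted F).1 F & incident (wanted F).2 F]) ->
  exists h, valid wanted h /\ even_graph h.
Proof.
move=> wantedP; have [z [zT zY]] := spans_triangles.
(* A triangle selects the vertex opposite to [z F] and an end of [z F]; [s] decides which end. *)
pose sel (s : face G -> bool) F :=
  if triangular F then (src (phi (phi (z F))), if s F then src (z F) else tgt (z F))
  else wanted F.
pose M F u := triangular F && ((src (z F) == u) (+) (tgt (z F) == u)).
pose p u := \big[addb/false]_F meets (sel xpred0) F u.
(* A kernel vector is constant on each [z F], hence on every edge, as every edge lies on a triangle.
   A constant is orthogonal to [p] because each selected pair has two members. *)
have [y ker|s sM] := @boolean_system _ _ M p.
  have inv F : triangular F -> y (src (z F)) = y (tgt (z F)).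
    move=> tF; have := ker F; rewrite /M tF.
    rewrite (big_meets (fun F => (src (z F), tgt (z F)))) /=.
    by case: (y _); case: (y _).
  have invx x : y (src x) = y (tgt x).
    have un x' : tri x' -> y (src x') = y (tgt x').
      move=> tx; have := zY [set u | y u] _ x'; rewrite /uncrossed !inE => H.
      by apply/eqP/H => // F; rewrite !inE => /inv->.
    by have /orP[/un//|/un] := triangular_rev hG x.
  have yc := potential_constant invx.
  rewrite -(big_ends (sel xpred0) y) big1 // => F _.
  by rewrite (yc _ (sel xpred0 F).2) addbb.
exists (sel s); split.
  move=> F; rewrite /sel; case: ifP => [tF|/negbT nF]; last by have [? ? ?] := wantedP F nF.
  have [_ zF] : triangular F /\ face_of (z F) = F by apply: zT; rewrite inE.
  have tz : tri (z F) by rewrite zF.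
  have i1 : incident (src (phi (phi (z F)))) F.
    by rewrite -{2}zF -(face_of_phi (z F)) -(face_of_phi (phi _)) incident_src.
  split=> //=; last by case: (s F); rewrite -{2}zF ?incident_src ?incident_tgt.
  case: (s F); last by rewrite -src_phi [src (phi (phi _))]src_phi eq_sym src_neq_tgt.
  by rewrite -{2}(phi3 tz) [src (phi (phi (phi _)))]src_phi src_neq_tgt.
move=> u; rewrite -[RHS](addbb (p u)) -{2}(sM u) -big_split /=; apply: eq_bigr => F _.
rewrite /meets /sel /M; case: ifP => _; rewrite ?andbF ?addbF //=.
by case: (s F); rewrite ?addbF //=; do 3 case: eqP.
Qed.

(** Adjacent triangles, one reached and one not, allow an exchange. Without such a pair all
    triangles are reached, and so is every other face, because it shares a selected vertex with a
    triangle. *)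
Lemma merge_components wanted h v : valid wanted h -> even_graph h ->
  (exists F, F \in reach h v) -> reach h v != setT ->
  exists h', [/\ valid wanted h', even_graph h' & #|reach h v| < #|reach h' v|].
Proof.
move=> vh ev [F0 F0R] nT.
pose X := [set u | connect (link h) v u].
have ncX : no_crossing h X := @no_crossing_component _ _ h v.
have RX F : (F \in reach h v) = ((h F).1 \in X) by rewrite !inE.
have joinsX F p c : joins h F p c -> (p \in X) = (F \in reach h v) /\ (c \in X) = (F \in reach h v).
  by rewrite RX; case/orP => /eqP E; have := ncX F; rewrite E /= => ->.
(* Two of the three vertices are selected, so at least one of them is an end of [x]. *)
have triangle_end x : tri x -> exists p c, joins h (face_of x) p c /\ (p = src x \/ p = tgt x).
  move=> tx; have [ne i1 i2 _] := vh (face_of x).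
  have end1 p : p = (h (face_of x)).1 \/ p = (h (face_of x)).2 -> p = src x \/ p = tgt x ->
      exists p c, joins h (face_of x) p c /\ (p = src x \/ p = tgt x).
    by move=> /ends_joins[c jc] E; exists p, c.
  case: (triangle_vertices tx i1) => E1.
  - by apply: (end1 _ (or_introl erefl)); left.
  - by apply: (end1 _ (or_introl erefl)); right.
  case: (triangle_vertices tx i2) => E2.
  - by apply: (end1 _ (or_intror erefl)); left.
  - by apply: (end1 _ (or_intror erefl)); right.
  by rewrite E1 E2 eqxx in ne.
have [/existsP[x /and4P[tx tr xR rR]]|/existsPn none] := boolP [exists x,
    [&& tri x, tri (rev x), face_of x \in reach h v & face_of (rev x) \notin reach h v]].
  have [p [c [jf pE]]] := triangle_end x tx.
  have [q [d [jg qE]]] := triangle_end (rev x) tr; rewrite src_rev tgt_rev in qE.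
  have fg : face_of x != face_of (rev x) by apply: contraNneq rR => <-.
  have [pX cX] := joinsX _ _ _ jf; have [qX dX] := joinsX _ _ _ jg.
  rewrite xR in pX cX; rewrite (negbTE rR) in qX dX.
  exists (swap h (face_of x) (face_of (rev x)) p q c d); split.
  - move=> F; rewrite /swap; have [->|_] := eqVneq F (face_of x);
      last have [->|_] := eqVneq F (face_of (rev x)).
    + have [_ i1 i2 _] := vh (face_of x).
      split=> /=; last by rewrite tx.
      * by apply: contraTneq cX => <-; rewrite qX.
      * by case: qE => ->; rewrite ?incident_src ?incident_tgt.
      * by case/orP: jf i1 i2 => /eqP->.
    + have [_ i1 i2 _] := vh (face_of (rev x)).
      split=> /=; last by rewrite tr.
      * by apply: contraTneq pX => ->; rewrite dX.
      * case: pE => ->; first by rewrite -tgt_rev incident_tgt.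
        by rewrite -src_rev incident_src.
      * by case/orP: jg i1 i2 => /eqP->.
    + exact: vh.
  - exact: swap_even.
  - exact: swap_reach.
exfalso.
have half x : tri x -> tri (rev x) -> face_of x \in reach h v -> face_of (rev x) \in reach h v.
  by move=> tx tr xR; have := none x; rewrite tx tr xR /= negbK.
have adjR x : tri x -> tri (rev x) ->
    (face_of x \in reach h v) = (face_of (rev x) \in reach h v).
  move=> tx xr; apply/idP/idP; first exact: half.
  by rewrite -{2}[x]rev_dartK; apply: half; rewrite ?rev_dartK.
have triR := triangles_connected (P := fun F => F \in reach h v) hG adjR.
(* Evenness at a selected vertex of [F] gives a second face selecting it, which is a triangle by
   tightness. *)
have RR F : ~~ triangular F ->
    exists2 F', triangular F' & (F' \in reach h v) = (F \in reach h v).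
  move=> nF; pose u := (h F).1; have [ne i1 _ _] := vh F.
  have mF : meets h F u by rewrite /meets /u eqxx eq_sym (negbTE ne).
  have /existsP[F' /andP[nFF mF']] : [exists F', (F' != F) && meets h F' u].
    apply: contraT => /existsPn no; have := ev u; rewrite (bigD1 F) //= mF big1 // => F' nF'.
    by apply/negbTE; have := no F'; rewrite nF'.
  have [_ i1' i2' _] := vh F'.
  have uF' : u = (h F').1 \/ u = (h F').2.
    by move: mF'; rewrite /meets; case: eqP => [E|_]; [left|case: eqP => [E|//]; right].
  exists F'.
    apply: contraT => nF'; case: hG => _ /(_ F' F); rewrite !inE => /(_ nF' nF nFF u).
    by rewrite (i1 : incident u F) andbT => /negP[]; case: uF' => ->.
  by rewrite !RX -/u; case: uF' => -> //; apply: ncX.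
have toT F : exists2 F', triangular F' & (F' \in reach h v) = (F \in reach h v).
  by have [tF|/RR//] := boolP (triangular F); exists F.
have all F : F \in reach h v.
  have [F' t' <-] := toT F; have [F0' t0 E0] := toT F0.
  have [[x' Ex] [x0 Ex0]] := (face_of_surj F', face_of_surj F0').
  by rewrite -Ex (triR x' x0) ?Ex ?Ex0 // E0.
by case/eqP: nT; apply/setP=> F; rewrite all inE.
Qed.

Lemma connected_selection wanted h : valid wanted h -> even_graph h ->
  exists h', [/\ valid wanted h', even_graph h' & connected_graph h'].
Proof.
move=> vh ev; have [F0 _|noF] := pickP (@predT (face G)); last first.
  by exists h; split=> // Y nc F; have := noF F.
pose v := (h F0).1.
have: exists F, F \in reach h v by exists F0; rewrite inE connect0.
move: v => v {F0}; have [n] := ubnP (#|{: face G}| - #|reach h v|).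
elim: n h vh ev => // n IHn h vh ev ltn ne.
have [rT|nT] := eqVneq (reach h v) setT; first by exists h; split=> //; apply: reach_connected rT.
have [h' [vh' ev' lt]] := merge_components vh ev ne nT; apply: IHn vh' ev' _ _; last first.
  by apply/set0Pn; rewrite -card_gt0; apply: leq_trans lt.
rewrite -ltnS; apply: leq_trans ltn.
by rewrite ltnS ltn_sub2l // (leq_trans lt) ?max_card.
Qed.
End Selection.

(** * The tour as an Eulerian circuit of the selection *)

Theorem theorem8 (G : plane_graph) (hG : tight G)
    (m : nat) (f : 'I_m -> face G) (f_inj : injective f)
    (hf : nontriangular_faces G = [set f i | i : 'I_m])
    (v v' : 'I_m -> G)
    (hv : forall i : 'I_m, incident (v i) (f i))
    (hv' : forall i : 'I_m, incident (v' i) (f i))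
    (hvv' : forall i : 'I_m, v i <> v' i) :
  exists T : seq (seq (G * face G)),
    hamiltonian_tour T /\
    forall i : 'I_m, tour_contains T (v i) (f i) (v' i).
Proof.
(* The dart [x0] provides a face and a default pair for [wanted], taken only at triangles, where
   nothing is prescribed. *)
have [A [z [_ [x0 _]]]] := spans_cycle hG.
pose wanted F := if [pick i | f i == F] is Some i then (v i, v' i) else (src x0, src x0).
have wantedE i : wanted (f i) = (v i, v' i).
  by rewrite /wanted; case: pickP => [j /eqP/f_inj->//|/(_ i)]; rewrite eqxx.
have nontri i : ~~ triangular (f i).
  have : f i \in nontriangular_faces G by rewrite hf imset_f.
  by rewrite inE.
have [|h0 [vh0 ev0]] := @even_selection G hG wanted.
  move=> F nF; have : F \in nontriangular_faces G by rewrite inE.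
  by rewrite hf => /imsetP[i _ ->]; rewrite wantedE /=; split=> //; apply/eqP.
have [h [vh ev con]] := connected_selection hG vh0 ev0.
have [|l [l0 cl pl]] := euler_tour ev con; first by apply/card_gt0P; exists (face_of x0).
exists [:: l]; split.
  rewrite /hamiltonian_tour /spanning_tour /= cats0 pl !andbT /closed_component l0 /=.
  apply: sub_cycle cl => p q; have [ne i1 i2 _] := vh p.2.
  by rewrite /step => /orP[] /eqP E; rewrite E /= in ne i1 i2; rewrite ?ne ?i1 ?i2 // eq_sym ne.
move=> i; rewrite /tour_contains /= orbF.
have : f i \in map snd l by rewrite (perm_mem pl) mem_enum.
case/mapP=> -[u F] /= pl' E; rewrite -E in pl'.
have := next_cycle cl pl'; rewrite /step /joins /traverses /=.
have [_ _ _ ->//] := vh (f i); rewrite wantedE !xpair_eqE => /orP[] /andP[/eqP vu /eqP vw].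
  by rewrite vu pl' vw eqxx.
by rewrite vw pl' vu eqxx orbT.
Qed.
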